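(* Assume that $D_0, D_1, D_2, \dots$ are mutually different, and let $m\ge 1$ be an integer. On the solutions to $c_{m+1}(B)=0$ expressed as $$B = -D_k - D_k^{[1],(m+1)} s + O(s^2), \quad k=0,1,\dots,m,$$ we have $$D_k^{[1],(m+1)} = D_k^{[1],(k+2)} = E_k + \frac{k(k-1+\gamma)}{D_k-D_{k-1}}F_k + \frac{(k+1)(k+\gamma)}{D_k-D_{k+1}}F_{k+1}$$ for $k=1,\dots,m-1$, and $$D_0^{[1],(m+1)} = E_0 + \frac{\gamma}{D_0-D_1}F_1, \qquad D_m^{[1],(m+1)} = E_m + \frac{m(m-1+\gamma)}{D_m-D_{m-1}}F_m .$$
   Context: Let $\gamma \in \mathbb{C}$ with $\gamma \notin \{0,-1,-2,\dots\}$, and let $(D_m)_{m\ge 0}$, $(E_m)_{m\ge 0}$, $(F_m)_{m\ge 0}$ be sequences of complex numbers, independent of the variables $B$ and $s$. Define polynomials $c_m(B)$ in the variables $B$ and $s$ by $c_{-1}(B)=0$, $c_0(B)=1$ and $$c_{m+1}(B) = \frac{(B+D_m+sE_m)\,c_m(B) - sF_m\,c_{m-1}(B)}{(m+1)(m+\gamma)}, \quad m=0,1,2,\dots .$$ (The cases of interest have $D_m=m(m-1+\gamma+\delta)$ with: $E_m=m(m-1+\gamma+\epsilon)$, $F_m=(m-1+\alpha)(m-1+\beta)$, where $\gamma+\delta+\epsilon=\alpha+\beta+1$, for the Heun equation; $E_m=m$, $F_m=m-1+\alpha$ for the singly confluent Heun equation; $E_m=0$, $F_m=1$ for the reduced singly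 confluent Heun equation. For this $D_m$, mutual distinctness of $D_0,D_1,\dots$ is equivalent to $\gamma+\delta\notin\mathbb{Z}_{\le 0}$.) When $D_0,D_1,D_2,\dots$ are mutually different and $0\le k\le m$, the analytic implicit function theorem gives a unique germ of analytic function $D_{k,m+1}(s)$ at $s=0$ with $D_{k,m+1}(0)=D_k$ and $c_{m+1}(-D_{k,m+1}(s))=0$ for all $s$ near $0$. Its Taylor coefficients are denoted by $D_k^{[j],(m+1)}$: $$D_{k,m+1}(s) = D_k + \sum_{j=1}^{\infty} D_k^{[j],(m+1)} s^j .$$ The solution of $c_{m+1}(B)=0$ labelled by $k$ is $B=-D_{k,m+1}(s)$; $O(s^n)$ refers to $s\to 0$. *)

(* Defs.v *)
From HB Require Import structures.
From mathcomp Require Import all_boot all_order all_algebra.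
From mathcomp Require Import all_classical all_reals all_analysis.

Set Implicit Arguments.
Unset Strict Implicit.
Unset Printing Implicit Defensive.

Import Order.TTheory GRing.Theory Num.Theory.
Import numFieldNormedType.Exports.

Local Open Scope classical_set_scope.
Local Open Scope ring_scope.

(* Elements of {poly {poly K}} are polynomials in B (outer variable) with
   coefficients that are polynomials in s (inner variable). *)
Definition varB (K : numFieldType) : {poly {poly K}} := 'X.
Definition varS (K : numFieldType) : {poly {poly K}} := 'X%:P.
Definition cst (K : numFieldType) (z : K) : {poly {poly K}} := z%:P%:P.

(* The value 0 given to c_{n-1} when n = 0 is the convention c_{-1} = 0. *)
Fixpoint cpoly (K : numFieldType) (gamma : K) (D E F : nat -> K) (m : nat)
    : {poly {poly K}} :=
  if m is n.+1 then
    let c_n := cpoly gamma D E F n in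
    let c_n_minus_1 := if n is p.+1 then cpoly gamma D E F p else 0 in
    cst (n.+1%:R * (n%:R + gamma))^-1 *
      ((varB K + cst (D n) + varS K * cst (E n)) * c_n
       - varS K * cst (F n) * c_n_minus_1)
  else 1.

Definition eval_Bs (K : numFieldType) (p : {poly {poly K}}) (b s : K) : K :=
  p.[b%:P].[s].

Definition taylor_at0 (K : numFieldType) (f : K -> K) (a : nat -> K) : Prop :=
  \forall s \near (0 : K), series (fun j => a j * s ^+ j) @ \oo --> f s.

Definition analytic_at0 (K : numFieldType) (f : K -> K) : Prop :=
  exists a, taylor_at0 f a.

(* Meaningful for f analytic at 0, where the sequence a is unique. *)
Definition taylor_coef (K : numFieldType) (f : K -> K) : nat -> K :=
  xget (fun=> 0) [set a | taylor_at0 f a].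

Definition is_branch (K : numFieldType) (gamma : K) (D E F : nat -> K)
    (k n : nat) (f : K -> K) : Prop :=
  [/\ analytic_at0 f, f 0 = D k &
      \forall s \near (0 : K), eval_Bs (cpoly gamma D E F n) (- f s) s = 0].

(* A representative of the germ D_{k,n}(s).  When D is injective, gamma is not
   in {0,-1,-2,...} and k < n, such a germ exists and is unique by the analytic
   implicit function theorem; the default value 0 is only there to make the
   definition total. *)
Definition branch (K : numFieldType) (gamma : K) (D E F : nat -> K)
    (k n : nat) : K -> K :=
  xget (fun=> 0) [set f | is_branch gamma D E F k n f].

(* Dcoef gamma D E F k j n is D_k^{[j],(n)}. *)
Definition Dcoef (K : numFieldType) (gamma : K) (D E F : nat -> K)
    (k j n : nat) : K :=
  taylor_coef (branch gamma D E F k n) j.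

(* Main.v *)
Require Import Defs.
From HB Require Import structures.
From mathcomp Require Import all_boot all_order all_algebra.
From mathcomp Require Import all_classical all_reals all_analysis.
From mathcomp Require Import complex ring.

(** The theorem is a first-order perturbation computation once two analytic facts are
    available: that the branch through [(B, s) = (- D k, 0)] exists, and that its
    Taylor coefficients may be computed formally.

    Existence ([branch_spec]) is the analytic implicit function theorem for a
    polynomial equation at a simple root ([analytic_implicit_function]).  It reduces
    to a fixed-point equation [y = G(y, s)] where [G] has no constant term and no term
    linear in y alone.  The iterates are polynomials in s; each step fixes one more
    coefficient, and a submultiplicative weighted norm ([wnorm]) is bounded by the same
    constant on all of them.  A bound together with contact of order n at 0 gives
    geometric convergence of the iterates, hence of the series of their limiting
    coefficients ([analytic_fixpoint]).  Simplicity of the root is where the distinctness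
    of the [D i] and the condition on gamma enter ([deriv_cpoly_neq0]).

    Formal computation ([taylor_root]): if [f] has a Taylor series at 0 and
    [p(f(s), s) = 0] near 0, then substitution of the truncation of the series at order
    n into [p] gives a polynomial divisible by [s ^+ n].

    For [n = 2] and [p] the polynomial c_n, write [t_n + u_n s] for the value of c_n
    modulo [s ^+ 2] on [B = - D k - a s].  The recursion defining c_n gives
    [t_{n+1} = q_n (D_n - D_k) t_n] and
    [u_{n+1} = q_n ((D_n - D_k) u_n + (E_n - a) t_n - F_n t_{n-1})] with [q_n] nonzero.
    Hence [t_n] vanishes exactly for [n > k], and for [n >= k + 2] the slope [u_n] is
    multiplied by a nonzero number at each step.  The equation [u_n = 0] is therefore
    equivalent to [u_{k+1} = 0] when [n = k + 1], and to [u_{k+2} = 0] when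
    [n >= k + 2].  Solving these two linear equations for [a]
    ([first_taylor_coef]) gives the formulas. *)

Import Order.TTheory GRing.Theory Num.Theory.
Import numFieldNormedType.Exports.

Local Open Scope complex_scope.
Local Open Scope classical_set_scope.
Local Open Scope ring_scope.

(** * A weighted norm on polynomials in s *)

(** This is the norm of absolutely convergent power series on the closed disc of
    radius [r].  It is submultiplicative and dominates the sup norm on that disc, so
    a bound on it controls all the truncations of a power series at once. *)
Definition wnorm {K : numDomainType} (r : K) (p : {poly K}) : K :=
  \sum_(i < size p) `|p`_i| * r ^+ i.

Lemma wnorm_widen {K : numDomainType} (r : K) (p : {poly K}) (n : nat) :
  (size p <= n)%N -> wnorm r p = \sum_(i < n) `|p`_i| * r ^+ i.
Proof.
move=> le_pn; rewrite /wnorm (big_ord_widen n (fun i => `|p`_i| * r ^+ i)) //.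
rewrite big_mkcond /=; apply: eq_bigr => i _; case: ltnP => // le_pi.
by rewrite nth_default // normr0 mul0r.
Qed.

Lemma wnorm0 {K : numDomainType} (r : K) : wnorm r 0 = 0.
Proof. by rewrite /wnorm size_poly0 big_ord0. Qed.

Lemma wnorm_ge0 {K : numDomainType} (r : K) (p : {poly K}) : 0 <= r -> 0 <= wnorm r p.
Proof. by move=> r0; apply: sumr_ge0 => i _; rewrite mulr_ge0 ?exprn_ge0. Qed.

Lemma wnorm_cons {K : numDomainType} (r : K) (p : {poly K}) (c : K) :
  wnorm r (p * 'X + c%:P) = wnorm r p * r + `|c|.
Proof.
have sz : (size (p * 'X + c%:P)%R <= (size p).+1)%N.
  by rewrite size_MXaddC; case: ifP.
rewrite (wnorm_widen _ _ _ sz) big_ord_recl /= expr0 mulr1.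
rewrite coefD coefMX coefC eqxx add0r addrC; congr (_ + _).
rewrite /wnorm mulr_suml; apply: eq_bigr => i _.
by rewrite coefD coefMX coefC /= addr0 exprSr mulrA.
Qed.

Lemma wnormC {K : numDomainType} (r c : K) : wnorm r c%:P = `|c|.
Proof. by have := wnorm_cons r 0 c; rewrite mul0r add0r wnorm0 mul0r add0r. Qed.

Lemma wnormMXn {K : numDomainType} (r : K) (p : {poly K}) (k : nat) :
  wnorm r (p * 'X^k) = wnorm r p * r ^+ k.
Proof.
elim: k => [|k IHk]; first by rewrite !expr0 !mulr1.
have := wnorm_cons r (p * 'X^k) 0.
by rewrite polyC0 addr0 normr0 addr0 IHk !exprSr !mulrA.
Qed.

Lemma wnormD {K : numDomainType} (r : K) (p q : {poly K}) :
  0 <= r -> wnorm r (p + q) <= wnorm r p + wnorm r q.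
Proof.
move=> r0; pose n := maxn (size p) (size q).
rewrite (wnorm_widen r p n) ?leq_maxl // (wnorm_widen r q n) ?leq_maxr //.
rewrite (wnorm_widen r (p + q) n) ?size_polyD // -big_split /=.
by apply: ler_sum => i _; rewrite coefD -mulrDl ler_wpM2r ?exprn_ge0 // ler_normD.
Qed.

Lemma wnormZ {K : numDomainType} (r c : K) (p : {poly K}) :
  wnorm r (c *: p) = `|c| * wnorm r p.
Proof.
rewrite (wnorm_widen r (c *: p) (size p)) ?size_scale_leq // /wnorm mulr_sumr.
by apply: eq_bigr => i _; rewrite coefZ normrM mulrA.
Qed.

Lemma wnormB {K : numDomainType} (r : K) (p q : {poly K}) :
  0 <= r -> wnorm r (p - q) <= wnorm r p + wnorm r q.
Proof.
move=> r0; apply: le_trans (wnormD _ _ _ r0) _.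
by rewrite -[- q]scaleN1r wnormZ normrN1 mul1r.
Qed.

Lemma wnormM {K : numDomainType} (r : K) (p q : {poly K}) :
  0 <= r -> wnorm r (p * q) <= wnorm r p * wnorm r q.
Proof.
move=> r0; elim/poly_ind: p => [|p c IHp]; first by rewrite mul0r wnorm0 mul0r.
have -> : (p * 'X + c%:P) * q = p * q * 'X^1 + c *: q.
  by rewrite mulrDl mul_polyC expr1 mulrAC.
apply: le_trans (wnormD _ _ _ r0) _.
rewrite wnormMXn wnormZ wnorm_cons expr1 mulrDl lerD2r mulrAC.
by rewrite ler_wpM2r.
Qed.

Lemma wnormX {K : numDomainType} (r : K) (p : {poly K}) (k : nat) :
  0 <= r -> wnorm r (p ^+ k) <= wnorm r p ^+ k.
Proof.
move=> r0; elim: k => [|k IHk]; first by rewrite !expr0 -[1]/(1%:P) wnormC normr1.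
rewrite !exprS; apply: le_trans (wnormM _ _ _ r0) _.
by rewrite ler_wpM2l ?wnorm_ge0.
Qed.

Lemma wnorm_sum {K : numDomainType} (r : K) (n : nat) (p : 'I_n -> {poly K}) :
  0 <= r -> wnorm r (\sum_(i < n) p i) <= \sum_(i < n) wnorm r (p i).
Proof.
move=> r0; elim/big_ind2: _ => [|x1 x2 y1 y2 le1 le2|//]; first by rewrite wnorm0.
by apply: le_trans (wnormD _ _ _ r0) _; rewrite lerD.
Qed.

Lemma wnorm_take_poly {K : numDomainType} (r : K) (p : {poly K}) (n : nat) :
  0 <= r -> wnorm r (take_poly n p) <= wnorm r p.
Proof.
move=> r0; rewrite (wnorm_widen r _ n) ?size_take_poly //.
rewrite (wnorm_widen r p (n + size p)) ?leq_addl // big_split_ord /=.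
rewrite -[leLHS]addr0 lerD ?sumr_ge0 // => [|i _]; last by rewrite mulr_ge0 ?exprn_ge0.
by apply: ler_sum => i _; rewrite coef_take_poly ltn_ord.
Qed.

Lemma ler_wnorm {K : numDomainType} (r t : K) (p : {poly K}) :
  0 <= r -> r <= t -> wnorm r p <= wnorm t p.
Proof.
move=> r0 rt; apply: ler_sum => i _; rewrite ler_wpM2l // lerXn2r //.
by rewrite nnegrE (le_trans r0).
Qed.

Lemma horner_le_wnorm {K : numDomainType} (p : {poly K}) (s : K) :
  `|p.[s]| <= wnorm `|s| p.
Proof.
elim/poly_ind: p => [|p c IHp]; first by rewrite horner0 normr0 wnorm0.
rewrite wnorm_cons !hornerE; apply: le_trans (ler_normD _ _) _.
by rewrite lerD2r normrM ler_wpM2r.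
Qed.

(** * Truncation modulo powers of s *)

Lemma dvdXnP {K : fieldType} (p : {poly K}) (k : nat) :
  reflect (exists q, p = q * 'X^k) ('X^k %| p).
Proof. by apply: (iffP (Pdiv.Field.dvdpP _ _)) => -[q ->]; exists q. Qed.

Lemma dvdXP {K : fieldType} (p : {poly K}) : ('X %| p) = (p.[0] == 0).
Proof. by rewrite -['X]subr0 -polyC0 dvdp_XsubCl. Qed.

Lemma dvdXn_coef {K : fieldType} (p : {poly K}) (k : nat) :
  ('X^k %| p) <-> (forall j, (j < k)%N -> p`_j = 0).
Proof.
split=> [/dvdXnP[q ->] j jk|p0]; first by rewrite coefMXn jk.
have -> : p = drop_poly k p * 'X^k.
  rewrite -{1}(poly_take_drop k p) -[RHS]add0r; congr (_ + _).
  by apply/polyP => j; rewrite coef_take_poly coef0; case: ltnP => // /p0.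
exact: dvdp_mull.
Qed.

(** Schwarz lemma for the weighted norm: high order vanishing at 0 is a geometric
    gain strictly inside the disc. *)
Lemma horner_le_dvdXn {K : numFieldType} (r s : K) (p : {poly K}) (k : nat) :
  0 < r -> `|s| <= r -> 'X^k %| p -> `|p.[s]| <= wnorm r p * (`|s| / r) ^+ k.
Proof.
move=> r0 sr /dvdXnP[q ->].
rewrite wnormMXn hornerM hornerXn normrM normrX -mulrA -exprMn.
rewrite [r * _]mulrC divfK ?gt_eqF // ler_wpM2r ?exprn_ge0 //.
by apply: le_trans (horner_le_wnorm _ _) _; apply: ler_wnorm.
Qed.

(** Shrinking the radius makes the norm of a polynomial without constant term as
    small as wanted; this is what makes the fixed-point iteration stay in a ball. *)
Lemma wnorm_le_dvdX {K : numFieldType} (r : K) (p : {poly K}) :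
  0 <= r <= 1 -> p.[0] = 0 -> wnorm r p <= r * wnorm 1 p.
Proof.
move=> /andP[r0 r1] /eqP; rewrite -dvdXP -['X]expr1 => /dvdXnP[q ->].
rewrite !wnormMXn !expr1 mulr1 mulrC ler_wpM2l //; exact: ler_wnorm.
Qed.

(** * Substitution into polynomials *)

Lemma near0_ballP {K : numFieldType} (P : K -> Prop) :
  (\forall s \near (0 : K), P s) <-> exists2 d : K, 0 < d & forall s, `|s| < d -> P s.
Proof.
split=> [/nbhs_ballP[d d0 Pd]|[d d0 Pd]].
  exists d => // s sd; apply: Pd; rewrite -ball_normE /= sub0r normrN //.
apply/nbhs_ballP; exists d => // s; rewrite -ball_normE /= sub0r normrN; exact: Pd.
Qed.

Lemma cvg_horner {K : numFieldType} (p : {poly K}) (u : nat -> K) (x : K) :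
  u @ \oo --> x -> (fun n => p.[u n]) @ \oo --> p.[x].
Proof.
move=> ux; elim/poly_ind: p => [|p c IHp].
  rewrite horner0; under eq_fun do rewrite horner0; exact: cvg_cst.
rewrite !hornerE; under eq_fun do rewrite !hornerE.
by apply: cvgD; [apply: cvgM|apply: cvg_cst].
Qed.

Lemma horner2E {K : comNzRingType} (p : {poly {poly K}}) (w : {poly K}) (s : K) :
  p.[w].[s] = (map_poly (horner_eval s) p).[w.[s]].
Proof. by rewrite -[w.[s]]/(horner_eval s w) horner_map. Qed.

(** For truncated series this carries agreement modulo a power of s over to their
    images under substitution into [p]. *)
Lemma dvdp_sub_horner {K : fieldType} (p : {poly {poly K}}) (x y : {poly K}) :
  x - y %| p.[x] - p.[y].
Proof.
elim/poly_ind: p => [|p c IHp]; first by rewrite !horner0 subrr dvdp0.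
rewrite !hornerE.
have -> : p.[x] * x + c - (p.[y] * y + c) = (p.[x] - p.[y]) * x + p.[y] * (x - y) by ring.
by apply: dvdp_add; [apply: dvdp_mulr|apply: dvdp_mull].
Qed.

Lemma wnorm_horner {K : numDomainType} (r : K) (p : {poly {poly K}}) (w : {poly K}) :
  0 <= r -> wnorm r p.[w] <= \sum_(i < size p) wnorm r p`_i * wnorm r w ^+ i.
Proof.
move=> r0; rewrite horner_coef; apply: le_trans (wnorm_sum _ _ _ r0) _.
apply: ler_sum => i _; apply: le_trans (wnormM _ _ _ r0) _.
by rewrite ler_wpM2l ?wnorm_ge0 // wnormX.
Qed.

(** * From analytic to formal roots *)

(** Induction on [n]: the bound for [n.+1] gives the one for [n], hence
    [p = h * 'X^n] with [|h(s)| <= C |s|] off 0, and continuity of [h] forces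
    [h(0) = 0]. *)
Lemma dvdXn_of_bound {K : numFieldType} (p : {poly K}) (n : nat) (C d : K) :
  0 < d -> 0 <= C -> (forall s, `|s| <= d -> `|p.[s]| <= C * `|s| ^+ n) ->
  'X^n %| p.
Proof.
move=> d0; elim: n C => [|n IHn] C C0 bound; first by rewrite expr0 dvd1p.
have /dvdXnP[h ph] : 'X^n %| p.
  apply: (IHn (C * d)) => [|s sd]; first by rewrite mulr_ge0 // ltW.
  apply: le_trans (bound s sd) _.
  by rewrite exprS mulrA ler_wpM2r ?exprn_ge0 // ler_wpM2l.
suff h0 : 'X %| h.
  by rewrite ph exprS dvdp_mul2r ?expf_neq0 ?polyX_eq0.
rewrite dvdXP; elim/poly_ind: h ph => [|q c _] ph; first by rewrite horner0.
rewrite !hornerE; apply/negP => /negP c0.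
have c1 : 0 < `|c| by rewrite normr_gt0.
pose D := C + wnorm d q.
have D0 : 0 <= D by rewrite addr_ge0 // wnorm_ge0 // ltW.
(* Small enough that [e <= d] and [e * D < `|c|]. *)
pose e := ((D + 1) / `|c| + d^-1)^-1.
have e0 : 0 < e.
  by rewrite invr_gt0 addr_gt0 ?invr_gt0 // divr_gt0 // ltr_wpDl.
have ed : e <= d.
  rewrite -[leRHS]invrK lef_pV2 ?posrE ?invr_gt0 ?addr_gt0 ?divr_gt0 ?invr_gt0 //.
    by rewrite lerDr divr_ge0 // addr_ge0.
  by rewrite ltr_wpDl.
have ne : `|e| = e by rewrite gtr0_norm.
have hle : `|q.[e] * e + c| <= C * e.
  have := bound e; rewrite ne => /(_ ed).
  rewrite ph !hornerE normrM normrX ne exprS mulrA.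
  by rewrite ler_pM2r // exprn_gt0.
have cle : `|c| <= e * D.
  have -> : c = (q.[e] * e + c) - q.[e] * e by ring.
  apply: le_trans (ler_normB _ _) _.
  rewrite /D mulrDr lerD //; first by rewrite [e * C]mulrC.
  rewrite normrM ne mulrC ler_wpM2l ?(ltW e0) //.
  by apply: le_trans (horner_le_wnorm _ _) _; rewrite ne ler_wnorm // ltW.
have : e^-1 * `|c| <= D.
  by rewrite -(ler_pM2l e0) mulrA mulfV ?gt_eqF // mul1r.
apply/negP; rewrite lt_geF // invrK mulrDl divfK ?gt_eqF // -addrA ltrDl.
by rewrite addr_gt0 // mulr_gt0 // invr_gt0.
Qed.

Lemma sum_half_le {K : numFieldType} (n : nat) : \sum_(i < n) (2^-1 : K) ^+ i <= 2.
Proof.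
suff -> : \sum_(i < n) (2^-1 : K) ^+ i = 2 - 2 * 2^-1 ^+ n.
  by rewrite gerBl mulr_ge0 // exprn_ge0 // invr_ge0.
elim: n => [|n IHn]; first by rewrite big_ord0 expr0 mulr1 subrr.
by rewrite big_ord_recr /= IHn exprS mulrA mulfV ?pnatr_eq0 // mul1r; ring.
Qed.

Lemma cvg0_bounded {K : numFieldType} (u : nat -> K) :
  u @ \oo --> (0 : K) -> exists2 C : K, 0 <= C & forall n, `|u n| <= C.
Proof.
move=> /cvgrPdist_lt /(_ 1 ltr01) [N _ uN].
exists (1 + \sum_(i < N) `|u i|); first by rewrite addr_ge0 // sumr_ge0.
move=> n; case: (ltnP n N) => nN; last first.
  have := uN n nN; rewrite /= sub0r normrN => /ltW /le_trans -> //.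
  by rewrite lerDl sumr_ge0.
rewrite (bigD1 (Ordinal nN)) //= addrCA lerDl addr_ge0 // sumr_ge0 //.
Qed.

(** Both limits, in the number [N] of terms and in [s], are exchanged with the help
    of a uniform bound.  Let [w N] be the partial sums.  The polynomials [p.[w N]] are
    bounded in a weighted norm and agree with [p.[w n]] modulo [s^n], so
    [|p.[w n](s)| <= |p.[w N](s)| + b |s|^n] for a constant [b].  Letting [N] go to
    infinity removes the first term on the right, since the series converges to a
    root; [dvdXn_of_bound] concludes. *)
Lemma taylor_root {K : numFieldType} (p : {poly {poly K}}) (f : K -> K)
    (a : nat -> K) (n : nat) :
  taylor_at0 f a -> (\forall s \near (0 : K), p.[(f s)%:P].[s] = 0) ->
  'X^n %| p.[\poly_(j < n) a j].
Proof.
move=> fa pf; have [d d0 fd] := (near0_ballP _).1 (filterI fa pf).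
pose w N : {poly K} := \poly_(j < N) a j.
have wE N s : series (fun j => a j * s ^+ j) N = (w N).[s].
  by rewrite horner_poly /series /= big_mkord.
(* The terms are bounded at [d / 2], so they are summable with ratio 1/2 at [r]. *)
pose r := d / 2 / 2.
have d2 : 0 < d / 2 by rewrite divr_gt0.
have r0 : 0 < r by rewrite !divr_gt0.
have rd2 : r < d / 2 by rewrite ltr_pdivrMr // ltr_pMr // ltr1n.
have d2d : d / 2 < d by rewrite ltr_pdivrMr // ltr_pMr // ltr1n.
have [C C0 aC] : exists2 C : K, 0 <= C & forall j, `|a j * (d / 2) ^+ j| <= C.
  apply: cvg0_bounded.
  have [|sc _] := fd (d / 2); first by rewrite gtr0_norm.
  by apply: cvg_series_cvg_0; apply: cvgP sc.
have w_bound N : wnorm r (w N) <= C * 2.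
  rewrite (wnorm_widen r _ N) ?size_poly //.
  apply: (@le_trans _ _ (\sum_(i < N) C * 2^-1 ^+ i)).
    apply: ler_sum => i _; rewrite coef_poly ltn_ord /r exprMn mulrA.
    rewrite ler_wpM2r ?exprn_ge0 ?invr_ge0 //.
    by have := aC i; rewrite normrM normrX (gtr0_norm d2).
  by rewrite -mulr_sumr ler_wpM2l // sum_half_le.
(* The bound on [p.[w N]] that does not depend on [N]. *)
pose A := \sum_(i < size p) wnorm r p`_i * (C * 2) ^+ i.
have p_bound N : wnorm r p.[w N] <= A.
  apply: le_trans (wnorm_horner _ _ _ (ltW r0)) _; apply: ler_sum => i _.
  rewrite ler_wpM2l ?wnorm_ge0 ?(ltW r0) // lerXn2r ?nnegrE ?wnorm_ge0 ?(ltW r0) //.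
  by rewrite mulr_ge0.
have A0 : 0 <= A by apply: le_trans (p_bound 0%N); rewrite wnorm_ge0 // ltW.
apply: (@dvdXn_of_bound _ _ _ (2 * A / r ^+ n) r) => // [|s sr].
  by rewrite divr_ge0 ?mulr_ge0 ?exprn_ge0 // ltW.
have [|sc ps0] := fd s; first by apply: le_lt_trans sr (lt_trans rd2 d2d).
have pc : (fun N => p.[w N].[s]) @ \oo --> (0 : K).
  rewrite -ps0 horner2E hornerC; under eq_fun do rewrite horner2E.
  by apply: cvg_horner; under eq_fun do rewrite -wE.
rewrite mulrAC -mulrA -expr_div_n; apply/ler_addgt0Pr => e e0.
have /cvgrPdist_lt /(_ e e0) [N _ pN] := pc.
(* Far enough for [p.[w M]] to be small at [s] and for [w M] to extend [w n]. *)
pose M := maxn N n.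
have := pN M; rewrite /= leq_maxl sub0r normrN => /(_ isT) pM.
have -> : p.[\poly_(j < n) a j].[s] = (p.[w n] - p.[w M]).[s] + p.[w M].[s].
  by rewrite !hornerE subrK.
apply: le_trans (ler_normD _ _) _; apply: lerD; last exact: ltW.
apply: le_trans (horner_le_dvdXn _ _ _ n r0 sr _) _.
  apply: dvdp_trans (dvdp_sub_horner _ _ _).
  apply/dvdXn_coef => j jn; rewrite coefB !coef_poly jn.
  by rewrite (leq_trans jn (leq_maxr _ _)) subrr.
rewrite ler_wpM2r //; first by rewrite exprn_ge0 // divr_ge0 // ltW.
by apply: le_trans (wnormB _ _ _ (ltW r0)) _; rewrite mulrDl mul1r lerD.
Qed.

(** * Operations on Taylor series *)

Lemma taylor_at0_0 {K : numFieldType} (f : K -> K) (a : nat -> K) :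
  taylor_at0 f a -> a 0%N = f 0.
Proof.
move=> fa; have f0 := nbhs_singleton fa; rewrite /= in f0.
have a0 : series (fun j => a j * 0 ^+ j) @ \oo --> a 0%N.
  rewrite -cvg_shiftS.
  have -> : (fun n => series (fun j => a j * 0 ^+ j) n.+1) = (fun=> a 0%N).
    apply/funext => n; rewrite /series /= big_nat_recl //= expr0 mulr1 big1 ?addr0 //.
    by move=> i _; rewrite expr0n mulr0.
  exact: cvg_cst.
by apply: norm_cvg_unique a0 f0.
Qed.

Lemma taylor_at0N {K : numFieldType} (f : K -> K) (a : nat -> K) :
  taylor_at0 f a -> taylor_at0 (fun s => - f s) (fun j => - a j).
Proof.
apply: filterS => s fs.
have -> : series (fun j => - a j * s ^+ j) = (fun n => - series (fun j => a j * s ^+ j) n).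
  apply/funext => n; rewrite /series /= -sumrN.
  by apply: eq_bigr => i _; rewrite mulNr.
exact: cvgN.
Qed.

Lemma taylor_at0_shift {K : numFieldType} (f : K -> K) (a : nat -> K) (b : K) :
  taylor_at0 f a ->
  taylor_at0 (fun s => b + f s) (fun j => if j is 0%N then b + a 0%N else a j).
Proof.
apply: filterS => s fs; rewrite -cvg_shiftS.
set v := (X in X @ \oo --> _).
have -> : v = (fun n => b + series (fun j => a j * s ^+ j) n.+1).
  apply/funext => n; rewrite /v /series /= !big_nat_recl //=.
  by rewrite expr0 !mulr1 addrA.
by apply: cvgD; [apply: cvg_cst|rewrite cvg_shiftS].
Qed.

(** * Geometric convergence *)

(** The form in which completeness of the complex numbers enters the construction of
    branches.  Isolating it lets that construction take place over any number field
    with the topology of its norm. *)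
Definition geometrically_complete (K : numFieldType) : Prop :=
  forall (v : nat -> K) (C q : K), 0 <= q < 1 ->
    (forall n, `|v n.+1 - v n| <= C * q ^+ n) -> exists y : K, v @ \oo --> y.

Lemma cvg_complex {R : realType} (v : nat -> (R[i] : numFieldType)) (x y : R) :
  (fun n => complex.Re (v n)) @ \oo --> x ->
  (fun n => complex.Im (v n)) @ \oo --> y -> v @ \oo --> (x +i* y : (R[i] : numFieldType)).
Proof.
move=> vx vy; apply/cvgrPdist_lt => e e0.
have eR : (complex.Re e)%:C = e by apply: RRe_real; apply: gtr0_real.
have e2 : 0 < complex.Re e / 2 by rewrite divr_gt0 // -(ltcR 0) eR.
move/cvgrPdist_lt/(_ _ e2): vx => [N1 _ vx].
move/cvgrPdist_lt/(_ _ e2): vy => [N2 _ vy].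
exists (maxn N1 N2) => // n /=; rewrite geq_max => /andP[n1 n2].
have := vx n n1; have := vy n n2; case: (v n) => a b /= yb xa.
have -> : (x +i* y) - (a +i* b) = (x - a)%:C + 'i * (y - b)%:C :> R[i].
  by rewrite [LHS]complexE /=.
apply: le_lt_trans (ler_normD _ _) _.
rewrite normrM !normc_def /= !expr0n /= !addr0 add0r expr1n sqrtr1 mul1r.
by rewrite !sqrtr_sqr -eR -rmorphD /= ltcR [ltRHS]splitr ltrD.
Qed.

Lemma cvg_steps {R : realType} (v : nat -> R) (C q : R) :
  0 <= q < 1 -> (forall n, `|v n.+1 - v n| <= C * q ^+ n) -> cvgn v.
Proof.
move=> /andP[q0 q1] v_step.
have cs : cvgn (series (fun n => v n.+1 - v n)).
  apply: normed_cvg; apply: (series_le_cvg _ _ v_step) => [n|n|] /=.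
  - exact: normr_ge0.
  - exact: le_trans (v_step n).
  - by apply: is_cvg_geometric_series; rewrite ger0_norm.
have -> : v = (fun n => v 0%N + series (fun n => v n.+1 - v n) n).
  apply/funext => n; rewrite /series /= telescope_sumr //.
  by rewrite addrC subrK.
by apply: is_cvgD => //; apply: is_cvg_cst.
Qed.

(** Real and imaginary parts inherit the geometric bound, so completeness of the
    reals applies to each of them. *)
Lemma complex_geometrically_complete (R : realType) :
  geometrically_complete (R[i] : numFieldType).
Proof.
move=> v C q /andP[q0 q1] v_step.
have C0 : 0 <= C by have := v_step 0%N; rewrite expr0 mulr1; apply: le_trans.
have qR : (complex.Re q)%:C = q by apply: RRe_real; apply: ger0_real.
have CR : (complex.Re C)%:C = C by apply: RRe_real; apply: ger0_real.
have q01 : 0 <= complex.Re q < 1 by rewrite -ler0c -(ltcR _ 1) qR q0.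
have bound n : C * q ^+ n = (complex.Re C * complex.Re q ^+ n)%:C.
  by rewrite -qR -CR /= rmorphM rmorphXn.
have cRe : cvgn (fun n => complex.Re (v n)).
  apply: (cvg_steps _ (complex.Re C) _ q01) => n.
  rewrite -lecR -bound; apply: le_trans (v_step n).
  by rewrite -raddfB; apply: normc_ge_Re.
have cIm : cvgn (fun n => complex.Im (v n)).
  apply: (cvg_steps _ (complex.Re C) _ q01) => n.
  rewrite -lecR -bound; apply: le_trans (v_step n).
  rewrite -raddfB -normrN -ReiNIm; apply: le_trans (normc_ge_Re _) _.
  by rewrite normrM [X in _ * X]normc_def /= expr0n add0r expr1n sqrtr1 mulr1.
by exists (limn (fun n => complex.Re (v n)) +i* limn (fun n => complex.Im (v n)));
  apply: cvg_complex.
Qed.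

(** Without an Archimedean hypothesis, powers of [q < 1] need not tend to 0.  Here
    completeness gives them a limit [y], and shifting the sequence yields
    [y = q * y]. *)
Lemma cvg_geometric0 {K : numFieldType} (q : K) :
  geometrically_complete K -> 0 <= q < 1 -> (fun n => q ^+ n) @ \oo --> (0 : K).
Proof.
move=> Kc q01; have /andP[q0 q1] := q01.
have [|y qy] := Kc (fun n => q ^+ n) 1 q q01.
  move=> n; rewrite exprS -{2}[q ^+ n]mul1r -mulrBl normrM.
  rewrite [`|q ^+ n|]ger0_norm ?exprn_ge0 // ler_wpM2r ?exprn_ge0 //.
  by rewrite distrC ger0_norm ?subr_ge0 ?(ltW q1) // gerBl.
suff y0 : y = 0 by rewrite -[X in _ --> X]y0.
have qy1 : (fun n => q ^+ n.+1) @ \oo --> q * y.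
  under eq_fun => n do rewrite exprS.
  by apply: cvgM => //; apply: cvg_cst.
have qy2 : (fun n => q ^+ n.+1) @ \oo --> y.
  by rewrite -(cvg_shiftS (fun n => q ^+ n)) in qy.
have : q * y = y by apply: norm_cvg_unique qy1 qy2.
move=> /eqP; rewrite -subr_eq0 -{2}[y]mul1r -mulrBl mulf_eq0 subr_eq0 => /orP[/eqP q1E|/eqP//].
by rewrite q1E ltxx in q1.
Qed.

Lemma cvg0_geometric_bound {K : numFieldType} (u : nat -> K) (C q : K) :
  geometrically_complete K -> 0 <= q < 1 ->
  (forall n, `|u n| <= C * q ^+ n) -> u @ \oo --> (0 : K).
Proof.
move=> Kc q01 uC.
have c0 : (fun n => C * q ^+ n) @ \oo --> (0 : K).
  by rewrite -[0](mulr0 C); apply: cvgM; [apply: cvg_cst|apply: cvg_geometric0].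
apply/cvgrPdist_lt => e e0; have /cvgrPdist_lt/(_ e e0)[N _ cN] := c0.
exists N => // n /cN; rewrite /= !sub0r !normrN; apply: le_lt_trans.
by apply: le_trans (uC n) _; rewrite ger0_norm // (le_trans _ (uC n)).
Qed.

(** * Analytic implicit functions by fixed-point iteration *)

Lemma horner_const {K : comNzRingType} (G : {poly {poly K}}) (y : {poly K}) :
  y.[0] = 0 -> G.[y].[0] = (G`_0).[0].
Proof.
move=> y0; rewrite horner2E y0 !horner_coef0.
by rewrite coef_map_id0 /horner_eval ?horner_coef0 ?coef0.
Qed.

(** If [G(y, s)] has neither a constant term nor a term linear in y alone, then
    substitution into [G] gains one order of contact: [G.[x] - G.[y]] is [x - y] times
    a cofactor whose value at [s = 0] is that of the linear coefficient of [G]. *)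
Lemma horner_contract {K : fieldType} (G : {poly {poly K}}) (x y : {poly K}) (k : nat) :
  (G`_1).[0] = 0 -> x.[0] = 0 -> y.[0] = 0 -> 'X^k %| x - y ->
  'X^(k.+1) %| G.[x] - G.[y].
Proof.
move=> G1 x0 y0 xy.
suff [Q -> Q0] : exists2 Q, G.[x] - G.[y] = (x - y) * Q & Q.[0] = (G`_1).[0].
  by rewrite exprSr dvdp_mul // dvdXP Q0 G1.
elim/poly_ind: G {G1} => [|p c [Q pQ _]].
  by exists 0; rewrite ?coef0 ?horner0 ?mulr0 ?subrr.
exists (Q * x + p.[y]); first by rewrite !hornerE mulrDr mulrA -pQ; ring.
rewrite coefD coefMX coefC /= addr0 !hornerE x0 mulr0 add0r.
exact: horner_const.
Qed.

(** The formal solution of [y = G(y, s)] is the limit of the iterates of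
    [y |-> G(y, s)] from 0, since each step fixes one more coefficient.  The
    series converges because the iteration preserves a ball of the weighted norm.
    With [A] the sum of the norms of the coefficients of [G] for radius 1, each
    monomial of [G] contributes at most its norm times [M ^+ 2] when [y] has norm at
    most [M <= 1] and the radius is [M ^+ 2]: the coefficient of y^0 and that of y^1
    give a factor [M ^+ 2] since they vanish at [s = 0], the others give [M ^+ 2] from
    y itself.  So [M = (1 + A)^-1] works, because then [A * M ^+ 2 <= M]. *)
Lemma analytic_fixpoint {K : numFieldType} (G : {poly {poly K}}) :
  geometrically_complete K ->
  (G`_0).[0] = 0 -> (G`_1).[0] = 0 ->
  exists2 a : nat -> K, a 0%N = 0 &
    \forall s \near (0 : K), exists2 y : K,
      series (fun j => a j * s ^+ j) @ \oo --> y & G.[y%:P].[s] = y.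
Proof.
move=> Kc G0 G1; pose Y n := iter n (fun y => G.[y]) 0.
have Y0 n : (Y n).[0] = 0.
  by elim: n => [|n IHn]; rewrite ?horner0 // /Y iterS horner_const.
have Ystep n : 'X^(n.+1) %| Y n.+1 - Y n.
  elim: n => [|n IHn]; last exact: (horner_contract G (Y n.+1) (Y n)).
  by rewrite expr1 dvdXP hornerD hornerN !Y0 subrr.
pose A := \sum_(i < size G) wnorm 1 G`_i.
have A0 : 0 <= A by apply: sumr_ge0 => i _; rewrite wnorm_ge0.
pose M := (1 + A)^-1.
have A1 : 0 < 1 + A by rewrite ltr_wpDr.
have M0 : 0 < M by rewrite invr_gt0.
have M1 : M <= 1 by rewrite invf_le1 // lerDl.
pose r := M ^+ 2.
have r0 : 0 < r by rewrite exprn_gt0.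
have r1 : r <= 1 by rewrite exprn_ile1 // ltW.
have YM n : wnorm r (Y n) <= M.
  elim: n => [|n IHn]; first by rewrite wnorm0 ltW.
  rewrite /Y iterS -/(Y n); apply: le_trans (wnorm_horner _ _ _ (ltW r0)) _.
  apply: (@le_trans _ _ (A * M ^+ 2)); last first.
    by rewrite expr2 mulrA ler_piMl ?(ltW M0) // /M ler_pdivrMr // mul1r lerDr.
  rewrite mulr_suml; apply: ler_sum => -[i /= _] _.
  have le1 : wnorm r G`_i <= wnorm 1 G`_i by rewrite ler_wnorm // ltW.
  have le2 : (G`_i).[0] = 0 -> wnorm r G`_i <= M ^+ 2 * wnorm 1 G`_i.
    by apply: wnorm_le_dvdX; rewrite ltW.
  have wi : wnorm r (Y n) ^+ i <= M ^+ i.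
    by rewrite lerXn2r ?nnegrE ?wnorm_ge0 // ltW.
  (* For [i <= 1] the factor [M ^+ 2] comes from the coefficient, else from [Y n]. *)
  have [i2|] := ltnP 1 i.
    apply: ler_pM => //; rewrite ?exprn_ge0 ?wnorm_ge0 ?(ltW r0) //.
    by apply: le_trans wi _; rewrite ler_wiXn2l // ltW.
  have w1 : wnorm r (Y n) ^+ i <= 1.
    by apply: le_trans wi _; rewrite exprn_ile1 // ltW.
  have Gi : (i <= 1)%N -> wnorm r G`_i <= M ^+ 2 * wnorm 1 G`_i.
    by move=> i1; apply: le2; case: i i1 {le1 wi w1} => [|[|]].
  move=> /Gi {}Gi; rewrite mulrC; apply: le_trans (_ : _ <= 1 * wnorm r G`_i) _.
    by rewrite ler_wpM2r ?wnorm_ge0 // ltW.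
  by rewrite mul1r mulrC.
have Ycoef n j : (j <= n)%N -> (Y n)`_j = (Y j)`_j.
  elim: n => [|n IHn]; first by rewrite leqn0 => /eqP->.
  rewrite leq_eqVlt => /orP[/eqP->//|]; rewrite ltnS => jn; rewrite -IHn //.
  by apply/eqP; rewrite -subr_eq0 -coefB; apply/eqP/(dvdXn_coef _ n.+1).1.
(* By [Ycoef] the coefficient of index [j] is final from the [j]-th iterate on. *)
pose a j := (Y j)`_j; exists a; first by rewrite /a coef0.
apply/near0_ballP; exists r => // s sr.
pose q := `|s| / r.
have q01 : 0 <= q < 1 by rewrite divr_ge0 ?(ltW r0) //= ltr_pdivrMr // mul1r.
have [y Yy] : exists y : K, (fun n => (Y n).[s]) @ \oo --> y.
  apply: (Kc _ (2 * M * q) q q01) => n.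
  rewrite -hornerN -hornerD -[X in _ <= X]mulrA -exprS.
  apply: le_trans (horner_le_dvdXn _ _ _ _ r0 (ltW sr) (Ystep n)) _.
  rewrite ler_wpM2r ?exprn_ge0 ?(andP q01).1 //.
  by apply: le_trans (wnormB _ _ _ (ltW r0)) _; rewrite mulrDl mul1r lerD.
exists y; last first.
  have GY : (fun n => (Y n.+1).[s]) @ \oo --> G.[y%:P].[s].
    rewrite horner2E hornerC; under eq_fun => n do rewrite /Y iterS -/(Y n) horner2E.
    exact: cvg_horner.
  have Yy1 : (fun n => (Y n.+1).[s]) @ \oo --> y.
    by rewrite -(cvg_shiftS (fun n => (Y n).[s])) in Yy.
  by apply: norm_cvg_unique GY Yy1.
have sE n : series (fun j => a j * s ^+ j) n = (take_poly n (Y n)).[s].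
  rewrite /series /= big_mkord /take_poly horner_poly.
  by apply: eq_bigr => i _; rewrite Ycoef // ltnW.
have -> : series (fun j => a j * s ^+ j) =
    (fun n => (Y n).[s] + (take_poly n (Y n) - Y n).[s]).
  by apply/funext => n; rewrite sE hornerD hornerN addrC subrK.
rewrite -[y]addr0; apply: cvgD => //.
apply: (cvg0_geometric_bound _ (2 * M) q Kc q01) => n.
apply: le_trans (horner_le_dvdXn _ _ _ n r0 (ltW sr) _) _.
  by apply/dvdXn_coef => j jn; rewrite coefB coef_take_poly jn subrr.
rewrite ler_wpM2r ?exprn_ge0 ?(andP q01).1 //.
apply: le_trans (wnormB _ _ _ (ltW r0)) _; rewrite mulrDl mul1r lerD //.
by apply: le_trans (wnorm_take_poly _ _ _ (ltW r0)) _.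
Qed.

(** Newton's method with frozen derivative: after translation by [b], the roots of
    [p] are the fixed points of [y - p(b + y, s) / l], where [l] is the derivative of
    [p] in its first variable at [(b, 0)].  This function of [(y, s)] has no linear
    term in y alone, so the fixed-point lemma applies. *)
Lemma analytic_implicit_function {K : numFieldType} (p : {poly {poly K}}) (b : K) :
  geometrically_complete K -> p.[b%:P].[0] = 0 -> p^`().[b%:P].[0] != 0 ->
  exists f : K -> K, [/\ analytic_at0 f, f 0 = b &
    \forall s \near (0 : K), p.[(f s)%:P].[s] = 0].
Proof.
move=> Kc pb dpb; pose l := p^`().[b%:P].[0].
pose q : {poly {poly K}} := p \Po ('X + b%:P%:P).
pose G : {poly {poly K}} := 'X - l^-1%:P%:P * q.
have GE w : G.[w] = w - l^-1%:P * p.[w + b%:P].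
  by rewrite !hornerE horner_comp !hornerE.
have G0 : (G`_0).[0] = 0.
  by rewrite -horner_coef0 GE sub0r add0r !hornerE pb mulr0 oppr0.
have G1 : (G`_1).[0] = 0.
  have -> : G`_1 = G^`().[0] by rewrite horner_coef0 coef_deriv.
  rewrite /G derivB derivX derivM !derivC mul0r add0r deriv_comp derivD derivX derivC.
  rewrite addr0 mulr1 !hornerE horner_comp !hornerE -/l.
  by rewrite mulVf // subrr.
have [a a0 aG] := analytic_fixpoint G Kc G0 G1.
pose y s := limn (series (fun j => a j * s ^+ j)).
have yP : \forall s \near (0 : K),
    series (fun j => a j * s ^+ j) @ \oo --> y s /\ G.[(y s)%:P].[s] = y s.
  apply: filterS aG => s [z az Gz].
  by have -> : y s = z by apply: (cvg_lim (@norm_hausdorff _ _)) az.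
have ya : taylor_at0 y a by apply: filterS yP => s [].
exists (fun s => b + y s); split.
- by exists (fun j => if j is 0%N then b + a 0%N else a j); apply: taylor_at0_shift.
- by rewrite -(taylor_at0_0 _ _ ya) a0 addr0.
apply: filterS yP => s [_]; rewrite GE !hornerE -polyCD [y s + b]addrC => /eqP.
rewrite -subr_eq0 addrAC subrr sub0r oppr_eq0 mulf_eq0 invr_eq0 (negPf dpb) /=.
by move=> /eqP.
Qed.

(** * The recursion along a branch *)

Definition step_factor {K : numFieldType} (gamma : K) (n : nat) : K :=
  (n.+1%:R * (n%:R + gamma))^-1.

Definition cpoly_prev {K : numFieldType} (gamma : K) (D E F : nat -> K) (n : nat)
    : {poly {poly K}} :=
  if n is p.+1 then cpoly gamma D E F p else 0.

(** By [coef0_cpoly] this is the constant term of c_n along every branch through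
    [(B, s) = (- D k, 0)]. *)
Definition cpoly_val0 {K : numFieldType} (gamma : K) (D E F : nat -> K) (k n : nat) : K :=
  (cpoly gamma D E F n).[(- D k)%:P].[0].

Lemma step_denominator_neq0 {K : numFieldType} (gamma : K) (n : nat) :
  (forall i : nat, gamma <> - i%:R) -> n.+1%:R * (n%:R + gamma) != 0.
Proof.
by move=> hgamma; rewrite mulf_neq0 ?pnatr_eq0 // addrC addr_eq0; apply/eqP/hgamma.
Qed.

Lemma step_factor_neq0 {K : numFieldType} (gamma : K) (n : nat) :
  (forall i : nat, gamma <> - i%:R) -> step_factor gamma n != 0.
Proof. by move=> hgamma; rewrite invr_eq0 step_denominator_neq0. Qed.

Lemma sub_inj_neq0 {K : numFieldType} (D : nat -> K) (i j : nat) :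
  injective D -> i != j -> D i - D j != 0.
Proof. by move=> hD; rewrite subr_eq0 (inj_eq hD). Qed.

Lemma cpolyS {K : numFieldType} (gamma : K) (D E F : nat -> K) (n : nat) :
  cpoly gamma D E F n.+1 =
  Defs.cst (step_factor gamma n) *
    ((varB K + Defs.cst (D n) + varS K * Defs.cst (E n)) * cpoly gamma D E F n
     - varS K * Defs.cst (F n) * cpoly_prev gamma D E F n).
Proof. by []. Qed.

Lemma cpoly_val0S {K : numFieldType} (gamma : K) (D E F : nat -> K) (k n : nat) :
  cpoly_val0 gamma D E F k n.+1 =
    step_factor gamma n * ((D n - D k) * cpoly_val0 gamma D E F k n).
Proof.
rewrite /cpoly_val0 cpolyS /Defs.cst /varB /varS !hornerE /= subr0.
by rewrite [- D k + _]addrC mulrA.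
Qed.

Lemma cpoly_val0_neq0 {K : numFieldType} (gamma : K) (D E F : nat -> K) (k n : nat) :
  (forall i : nat, gamma <> - i%:R) -> injective D -> (n <= k)%N ->
  cpoly_val0 gamma D E F k n != 0.
Proof.
move=> hgamma hD; elim: n => [|n IHn] nk; first by rewrite /cpoly_val0 /= !hornerE oner_eq0.
by rewrite cpoly_val0S !mulf_neq0 ?step_factor_neq0 ?IHn ?sub_inj_neq0 ?ltn_eqF // ltnW.
Qed.

Lemma cpoly_val0_eq0 {K : numFieldType} (gamma : K) (D E F : nat -> K) (k n : nat) :
  (k < n)%N -> cpoly_val0 gamma D E F k n = 0.
Proof.
elim: n => [//|n IHn]; rewrite ltnS leq_eqVlt cpoly_val0S => /orP[/eqP->|/IHn->].
  by rewrite subrr mul0r mulr0.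
by rewrite !mulr0.
Qed.

(** At [s = 0], c_n is a nonzero multiple of the product of the [B + D i], [i < n];
    its roots are simple because the [D i] are distinct. *)
Lemma deriv_cpoly_neq0 {K : numFieldType} (gamma : K) (D E F : nat -> K) (k n : nat) :
  (forall i : nat, gamma <> - i%:R) -> injective D -> (k < n)%N ->
  (cpoly gamma D E F n)^`().[(- D k)%:P].[0] != 0.
Proof.
move=> hgamma hD; elim: n => [//|n IHn] kn.
have -> : (cpoly gamma D E F n.+1)^`().[(- D k)%:P].[0] =
    step_factor gamma n * ((D n - D k) * (cpoly gamma D E F n)^`().[(- D k)%:P].[0]
                     + cpoly_val0 gamma D E F k n).
  by rewrite cpolyS /Defs.cst /varB /varS /cpoly_val0 !poly.derivE !hornerE; ring.
rewrite mulf_neq0 ?step_factor_neq0 //; move: kn; rewrite ltnS leq_eqVlt.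
case/orP=> [/eqP <-|kn]; first by rewrite subrr mul0r add0r cpoly_val0_neq0.
by rewrite cpoly_val0_eq0 // addr0 mulf_neq0 ?IHn // sub_inj_neq0 // gtn_eqF.
Qed.

(** The polynomial [\poly_(j < 2) - a j] is the branch [B = - a 0 - a 1 * s] modulo
    [s ^+ 2]. *)
Definition cpoly_slope {K : numFieldType} (gamma : K) (D E F : nat -> K) (a : nat -> K)
    (n : nat) : K :=
  (cpoly gamma D E F n).[\poly_(j < 2) - a j]`_1.

Lemma coef0_cpoly {K : numFieldType} (gamma : K) (D E F a : nat -> K) (k n : nat) :
  a 0%N = D k -> (cpoly gamma D E F n).[\poly_(j < 2) - a j]`_0 = cpoly_val0 gamma D E F k n.
Proof.
move=> a0; rewrite -horner_coef0 /cpoly_val0 !horner2E; congr (_.[_]).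
by rewrite hornerC horner_coef0 coef_poly /= a0.
Qed.

(** This is the recursion defining c_n, read modulo [s ^+ 2]. *)
Lemma cpoly_slopeS {K : numFieldType} (gamma : K) (D E F a : nat -> K) (k n : nat) :
  a 0%N = D k ->
  cpoly_slope gamma D E F a n.+1 = step_factor gamma n *
    ((D n - D k) * cpoly_slope gamma D E F a n + (E n - a 1%N) * cpoly_val0 gamma D E F k n
     - F n * if n is p.+1 then cpoly_val0 gamma D E F k p else 0).
Proof.
move=> a0; rewrite /cpoly_slope cpolyS /Defs.cst /varB /varS !hornerE.
have -> : (if n is p.+1 then cpoly_val0 gamma D E F k p else 0) =
    (cpoly_prev gamma D E F n).[\poly_(j < 2) - a j]`_0.
  by case: n => [|n] /=; [rewrite horner0 coef0|rewrite (coef0_cpoly _ _ _ _ _ k)].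
rewrite -(coef0_cpoly _ _ _ _ a k) //.
rewrite coefCM coefB -!mulrA coefXM /= coefCM; congr (_ * (_ - _)).
rewrite coefM !big_ord_recl big_ord0 /=.
rewrite !coefD !coef_poly !coefC !coefXM /= !coefC /= a0; ring.
Qed.

(** Once the last two constant terms vanish, the recursion for the slope is
    multiplication by a nonzero number.  This is why the first Taylor coefficient of
    the branch no longer depends on [n] from [n = k + 2] on. *)
Lemma cpoly_slope_eq0 {K : numFieldType} (gamma : K) (D E F a : nat -> K) (k d : nat) :
  (forall i : nat, gamma <> - i%:R) -> injective D -> a 0%N = D k ->
  cpoly_slope gamma D E F a (k + d).+2 = 0 -> cpoly_slope gamma D E F a k.+2 = 0.
Proof.
move=> hgamma hD a0; elim: d => [|d IHd]; first by rewrite addn0.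
rewrite addnS (cpoly_slopeS _ _ _ _ _ k) // !cpoly_val0_eq0; last 2 first.
- by rewrite ltnS leq_addr.
- by rewrite ltnS leqW // leq_addr.
rewrite !mulr0 subr0 addr0 => /eqP; rewrite !mulf_eq0 (negPf (step_factor_neq0 _ _ hgamma)) /=.
rewrite (negPf (sub_inj_neq0 _ _ _ hD _)) /= => [/eqP/IHd//|].
by rewrite gtn_eqF // ltnS leqW // leq_addr.
Qed.

(** Up to nonzero factors, the slope of c_{k+1} is [g - a 1], where [g] is the sum of
    the first two terms of the formula; the last term comes from one more step of the
    recursion, in which the constant term of c_k appears multiplied by [F k.+1].  For
    [k = 0] the second term vanishes because of its factor [k%:R], so that the dummy
    index [k - 1 = 0] is harmless. *)
Lemma first_taylor_coef {K : numFieldType} (gamma : K) (D E F a : nat -> K) (k n : nat) :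
  (forall i : nat, gamma <> - i%:R) -> injective D -> (k < n)%N -> a 0%N = D k ->
  cpoly_slope gamma D E F a n = 0 ->
  a 1%N = E k + k%:R * (k%:R - 1 + gamma) / (D k - D (k - 1)%N) * F k
    + (if n == k.+1 then 0 else
       (k%:R + 1) * (k%:R + gamma) / (D k - D (k + 1)%N) * F (k + 1)%N).
Proof.
move=> hgamma hD kn a0 un.
pose g := E k + k%:R * (k%:R - 1 + gamma) / (D k - D (k - 1)%N) * F k.
have tk : cpoly_val0 gamma D E F k k != 0 by rewrite cpoly_val0_neq0.
have kap := step_factor_neq0 gamma k hgamma.
have uk1 : cpoly_slope gamma D E F a k.+1 =
    step_factor gamma k * cpoly_val0 gamma D E F k k * (g - a 1%N).
  rewrite (cpoly_slopeS _ _ _ _ _ k) // subrr mul0r add0r -mulrA; congr (_ * _).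
  rewrite /g; case: k {kn a0 un g kap} tk => [|j] tk; first by rewrite !mul0r !mulr0; ring.
  rewrite subn1 /= (cpoly_val0S _ _ _ _ _ j) /step_factor.
  have := step_denominator_neq0 gamma j hgamma.
  have : D j.+1 - D j != 0 by rewrite sub_inj_neq0 // gtn_eqF.
  rewrite mulf_eq0 negb_or => Dj /andP[j1 jg]; field.
  by rewrite Dj jg nat1r j1.
case: (eqVneq n k.+1) => nk.
  move: un; rewrite nk uk1 => /eqP; rewrite !mulf_eq0 (negPf kap) (negPf tk) /=.
  by rewrite subr_eq0 addr0 => /eqP.
have uk2 : cpoly_slope gamma D E F a k.+2 = 0.
  apply: (cpoly_slope_eq0 _ _ _ _ _ _ (n - k.+2)) => //.
  by rewrite -!addSn subnKC // ltn_neqAle eq_sym nk.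
move: uk2; rewrite (cpoly_slopeS _ _ _ _ _ k) // uk1 [cpoly_val0 _ _ _ _ _ k.+1]cpoly_val0_eq0 //.
rewrite mulr0 addr0 => /eqP; rewrite mulf_eq0 (negPf (step_factor_neq0 _ _ hgamma)) /=.
have -> : (D k.+1 - D k) * (step_factor gamma k * cpoly_val0 gamma D E F k k * (g - a 1%N)) -
   F k.+1 * cpoly_val0 gamma D E F k k =
   cpoly_val0 gamma D E F k k *
     ((D k.+1 - D k) * step_factor gamma k * (g - a 1%N) - F k.+1) by ring.
rewrite mulf_eq0 (negPf tk) /= subr_eq0 => /eqP Fk.
rewrite addn1 -Fk -/g /step_factor.
have := step_denominator_neq0 gamma k hgamma.
have : D k - D k.+1 != 0 by rewrite sub_inj_neq0 // ltn_eqF.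
rewrite mulf_eq0 negb_or => Dk /andP[k1 kg]; field.
by rewrite Dk kg nat1r k1.
Qed.

(** * The first Taylor coefficient of a branch *)

(** The implicit function solves the equation for [B], and the branch is its
    opposite. *)
Lemma branch_spec {K : numFieldType} (gamma : K) (D E F : nat -> K) (k n : nat) :
  geometrically_complete K ->
  (forall i : nat, gamma <> - i%:R) -> injective D -> (k < n)%N ->
  is_branch gamma D E F k n (branch gamma D E F k n).
Proof.
move=> Kc hgamma hD kn.
have [g [[a ga] g0 pg]] := analytic_implicit_function (cpoly gamma D E F n) (- D k) Kc
  (cpoly_val0_eq0 gamma D E F k n kn) (deriv_cpoly_neq0 gamma D E F k n hgamma hD kn).
rewrite /branch; apply: (@xgetPex _ (fun=> 0) [set f | is_branch gamma D E F k n f]).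
exists (fun s => - g s); split; last first.
- by apply: filterS pg => s; rewrite /eval_Bs opprK.
- by rewrite g0 opprK.
by exists (fun j => - a j); apply: taylor_at0N.
Qed.

(** Whichever representative of the germ and whichever Taylor sequence are chosen,
    its truncation solves the equation modulo [s ^+ 2], and this determines its first
    two terms. *)
Lemma DcoefE {K : numFieldType} (gamma : K) (D E F : nat -> K) (k n : nat) :
  geometrically_complete K ->
  (forall i : nat, gamma <> - i%:R) -> injective D -> (k < n)%N ->
  Dcoef gamma D E F k 1 n =
    E k + k%:R * (k%:R - 1 + gamma) / (D k - D (k - 1)%N) * F k
    + (if n == k.+1 then 0 else
       (k%:R + 1) * (k%:R + gamma) / (D k - D (k + 1)%N) * F (k + 1)%N).
Proof.
move=> Kc hgamma hD kn.
have [f_an f0 f_root] := branch_spec gamma D E F k n Kc hgamma hD kn.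
set f := branch _ _ _ _ _ _ in f_an f0 f_root.
have fa : taylor_at0 f (taylor_coef f).
  by rewrite /taylor_coef; apply: (@xgetPex _ (fun=> 0) [set a | taylor_at0 f a]).
rewrite /Dcoef -/f; apply: (first_taylor_coef gamma D E F _ k n hgamma hD kn).
  by rewrite (taylor_at0_0 _ _ fa).
by apply: (dvdXn_coef _ 2).1 => //; apply: taylor_root (taylor_at0N _ _ fa) _.
Qed.

Theorem theorem4p6 (R : realType) (gamma : R[i])
    (hgamma : forall n : nat, gamma <> - n%:R)
    (D E F : nat -> R[i]) (hD : injective D)
    (m : nat) (hm : (1 <= m)%N) :
  (forall k : nat, (1 <= k <= m - 1)%N ->
     Dcoef gamma D E F k 1 (m + 1) = Dcoef gamma D E F k 1 (k + 2) /\
     Dcoef gamma D E F k 1 (k + 2) =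
       E k + k%:R * (k%:R - 1 + gamma) / (D k - D (k - 1)%N) * F k
           + (k%:R + 1) * (k%:R + gamma) / (D k - D (k + 1)%N) * F (k + 1)%N) /\
  Dcoef gamma D E F 0 1 (m + 1) = E 0%N + gamma / (D 0%N - D 1%N) * F 1%N /\
  Dcoef gamma D E F m 1 (m + 1) =
    E m + m%:R * (m%:R - 1 + gamma) / (D m - D (m - 1)%N) * F m.
Proof.
have Kc := complex_geometrically_complete R.
split; [|split].
- move=> k /andP[k1 km]; have {}km : (k < m)%N by rewrite -(subnK hm) addn1 ltnS.
  rewrite !(DcoefE _ _ _ _ _ _ Kc hgamma hD) ?addn1 ?addn2 //; last by rewrite ltnW.
  by rewrite !eqSS gtn_eqF // gtn_eqF.
- rewrite (DcoefE _ _ _ _ _ _ Kc hgamma hD) ?addn1 // eqSS gtn_eqF //.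
  by rewrite !mul0r addr0 !add0r mul1r.
by rewrite (DcoefE _ _ _ _ _ _ Kc hgamma hD) ?addn1 // eqxx addr0.
Qed.
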